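(* For any integers $n,m\ge1$, the system $f_{m+1,n}(x)=f_{m+2,n}(x)=\cdots=f_{m+n,n}(x)=0$, where $$f_{d,n}(x)=\sum_{k=0}^{d}(-1)^k\binom{d}{k}x_1^{k}x_2^{k^2}\cdots x_n^{k^n},$$ has a finite number of solutions in $(\mathbb{C}^* )^n$. In particular, $\mathbf{1}=(1,\dots,1)$ is an isolated common root.
   Context: $x=(x_1,\dots,x_n)$. *)

(* Defs.v *)
From HB Require Import structures.
From mathcomp Require Import all_boot all_order all_algebra.
From mathcomp Require Import complex.
From mathcomp Require Import all_classical all_reals all_analysis.

Set Implicit Arguments.
Unset Strict Implicit.
Unset Printing Implicit Defensive.

Import Order.TTheory GRing.Theory Num.Theory.
Import numFieldNormedType.Exports.

Local Open Scope ring_scope.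
Local Open Scope classical_set_scope.

(* The complex numbers are [R[i]] with [R : realType].  They are given the
   topology of their modulus, and ['rV[R[i]]_n] then gets the product
   topology. *)
HB.instance Definition _ (R : realType) :=
  PseudoPointedMetric.copy R[i] R[i]^o.
HB.instance Definition _ (R : realType) := NormedModule.copy R[i] R[i]^o.

(* The coordinate x_j of the paper, 1 <= j <= n, is [x 0 (j - 1)], which is
   why its exponent k^j appears as [(k ^ j.+1)%N]. *)
Definition fpoly (C : comNzRingType) (d n : nat) (x : 'rV[C]_n) : C :=
  \sum_(k < d.+1)
    (-1) ^+ k * 'C(d, k)%:R * \prod_(j < n) x 0 j ^+ (k ^ j.+1)%N.

Definition common_roots (R : realType) (m n : nat) : set 'rV[R[i]]_n :=
  [set x | forall i : nat, (1 <= i <= n)%N -> fpoly (m + i) x = 0].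

Definition torus (R : realType) (n : nat) : set 'rV[R[i]]_n :=
  [set x | forall j, x 0 j != 0].

Arguments common_roots : clear implicits.
Arguments torus : clear implicits.

(* Main.v *)
Require Import Defs.
From mathcomp Require Import all_boot all_order all_algebra all_field.
From mathcomp Require Import complex.
From mathcomp Require Import all_classical all_reals all_analysis.

(** Write [g k] for the monomial [x_1^k x_2^(k^2) ... x_n^(k^n)].  Then
    [fpoly d x] is, up to sign, the [d]-th forward difference of [g] at 0, so
    [x] is a common root exactly when the polynomial [p] of degree at most [m]
    that interpolates [g] at 0, ..., m also agrees with [g] at m+1, ..., m+n
    (lemma [newton_interpolation]).

    Two facts about [p] and [g] pull in opposite directions.  A polynomial of
    degree at most [m] that is small at [m+1] integers of [0, m+n] is small on
    all of them, so [|p k|] is comparable with its maximum for at least [n+1]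
    of these integers [k] ([large_values]).  On the other hand, [ln |g k|] is
    the value at [k] of a polynomial of degree at most [n] whose coefficients
    are 0 and the numbers [ln |x_j|].  Hence, at [n+1] integers, this polynomial
    is within a constant of [ln max |g|]; subtracting that number only changes
    the constant coefficient, and a polynomial of degree at most [n] that is
    bounded at [n+1] integers has bounded coefficients ([coef_bound]).  So all
    the [|x_j|] are bounded by a constant that depends only on [m] and [n]
    ([common_roots_torus_bounded]).

    It remains to see that a bounded constructible subset of an affine space
    over the complex numbers is finite ([bounded_definable_finite]).  By
    elimination of quantifiers its image under a coordinate is defined on the
    line by polynomial equations and inequations in one variable, so it is
    finite or cofinite; being bounded, it is finite.

    The point (1, ..., 1) is a common root because the alternating sum of a row
    of binomial coefficients is 0.  The torus is a neighborhood of that point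
    and finite sets are closed, so finiteness in the torus makes it isolated. *)

Set Implicit Arguments.
Unset Strict Implicit.
Unset Printing Implicit Defensive.

Import Order.TTheory GRing.Theory Num.Theory.
Import ComplexField.Normc.

Local Open Scope ring_scope.
Local Open Scope classical_set_scope.

(** * Polynomials bounded at integer points *)

Lemma natr_dist_ge1 (F : numFieldType) (i a : nat) :
  i != a -> 1 <= `|i%:R - a%:R : F|.
Proof.
wlog lt_ai : i a / (a < i)%N => [hw ia|_].
  have [lt_ia|lt_ai|/eqP/negPn] := ltngtP i a; last by rewrite ia.
    by rewrite distrC hw // eq_sym.
  exact: hw.
by rewrite -natrB ?normr_nat ?ler1n ?subn_gt0 // ltnW.
Qed.

(** Since distinct integers are at distance at least 1, dividing
    [p - p.[a]] by ['X - a] at a node [a] at most doubles the bound at the other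
    nodes; the constant therefore depends only on the number of nodes and on
    [N], whatever the nodes are. *)
Lemma coef_bound (F : numFieldType) (N d : nat) :
  exists K : nat, forall (s : seq nat) (p : {poly F}) (b : F),
    size s = d -> uniq s -> all (fun i => i <= N)%N s -> (size p <= d)%N ->
    {in s, forall i, `|p.[i%:R]| <= b} ->
  forall j, `|p`_j| <= K%:R * b.
Proof.
elim: d => [|d [K IH]].
  exists 0%N => s p b _ _ _; rewrite leqn0 size_poly_eq0 => /eqP-> _ j.
  by rewrite coef0 normr0 mul0r.
exists (K * 2 + N * (K * 2) + 1)%N => -[//|a s] p b [sz_s].
rewrite [all _ _]/= [uniq _]/= => /andP[a_s uniq_s] /andP[aN sN] sz_p le_b j.
have pa_b : `|p.[a%:R]| <= b by apply: le_b; rewrite mem_head.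
have [q def_q] : {q | p - p.[a%:R]%:P = q * ('X - a%:R%:P)}.
  by apply/sig_eqW/factor_theorem; rewrite rootE !hornerE subrr.
have sz_q : (size q <= d)%N.
  have [->|q0] := eqVneq q 0; first by rewrite size_poly0.
  have sz_qX : size (q * ('X - a%:R%:P)) = (size q).+1.
    by rewrite size_Mmonic ?monicXsubC // size_XsubC addn2.
  rewrite -ltnS -sz_qX -def_q (leq_trans (size_polyD _ _)) // geq_max.
  rewrite sz_p size_polyN.
  by rewrite (leq_trans (size_polyC_leq1 _)).
have le_q : {in s, forall i, `|q.[i%:R]| <= 2%:R * b}.
  move=> i i_s; have ia : i != a by apply: contraNneq a_s => <-.
  have /(congr1 Num.norm) : q.[i%:R] * (i%:R - a%:R) = p.[i%:R] - p.[a%:R].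
    by have /(congr1 (horner^~ i%:R)) := def_q; rewrite !hornerE => ->.
  rewrite normrM => def_qi.
  have : `|q.[i%:R]| <= `|p.[i%:R] - p.[a%:R]|.
    rewrite -def_qi ler_peMr //.
    exact: natr_dist_ge1.
  move/le_trans; apply; rewrite (le_trans (ler_normB _ _)) //.
  by rewrite mulr_natl mulr2n lerD // le_b // inE i_s orbT.
have {IH} coef_q := IH s q _ sz_s uniq_s sN sz_q le_q.
have -> : p = q * ('X - a%:R%:P) + p.[a%:R]%:P by rewrite -def_q subrK.
have b_ge0 : 0 <= b := le_trans (normr_ge0 _) pa_b.
rewrite mulrBr coefD coefB coefMX coefMC coefC !natrD !natrM !mulrDl.
rewrite (le_trans (ler_normD _ _)) // lerD //; last first.
  by case: (j == 0%N); rewrite mul1r ?normr0.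
rewrite (le_trans (ler_normB _ _)) // lerD //.
  by case: (j == 0%N); rewrite -?mulrA ?coef_q // normr0 !mulr_ge0.
rewrite normrM normr_nat mulrC -!mulrA ler_pM // ?ler_nat //.
Qed.

Lemma value_bound (F : numFieldType) (N d : nat) :
  exists c : nat, forall (s : seq nat) (p : {poly F}) (b : F),
    size s = d -> uniq s -> all (fun i => i <= N)%N s -> (size p <= d)%N ->
    {in s, forall i, `|p.[i%:R]| <= b} ->
  forall l, (l <= N)%N -> `|p.[l%:R]| <= c%:R * b.
Proof.
have [K coefP] := coef_bound F N d.
exists (\sum_(j < d) K * N ^ j)%N => s p b sz_s uniq_s sN sz_p le_b l lN.
have {}coefP := coefP s p b sz_s uniq_s sN sz_p le_b.
rewrite (horner_coef_wide _ sz_p) (le_trans (ler_norm_sum _ _ _)) //.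
rewrite natr_sum mulr_suml ler_sum // => j _.
rewrite normrM normrX normr_nat natrM mulrAC natrX ler_pM //.
by rewrite lerXn2r ?nnegrE ?ler0n ?ler_nat.
Qed.

(** The number of nodes where [p] is much smaller than at [k0] is at most [m]:
    otherwise [p] would be determined by [m + 1] values that are too small to
    give its value at [k0]. *)
Lemma large_values (F : numFieldType) (n m : nat) :
  exists c : nat, forall (p : {poly F}) (k0 : nat),
    (size p <= m.+1)%N -> (k0 <= m + n)%N ->
  exists s : seq nat, [/\ size s = n.+1, uniq s, all (fun i => i <= m + n)%N s &
    {in s, forall k, `|p.[k0%:R]| <= c.+1%:R * `|p.[k%:R]|}].
Proof.
have [c valP] := value_bound F (m + n) m.+1.
exists c => p k0 sz_p k0N.
pose big k := `|p.[k0%:R]| <= c.+1%:R * `|p.[k%:R]|.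
pose nodes := iota 0 (m + n).+1.
have nodesE k : (k \in nodes) = (k <= m + n)%N by rewrite mem_iota ltnS.
have few : (count (predC big) nodes <= m)%N.
  rewrite leqNgt; apply/negP => many.
  pose s := take m.+1 [seq k <- nodes | predC big k].
  have s_small : {in s, forall k, ~~ big k && (k <= m + n)%N}.
    by move=> k /mem_take; rewrite mem_filter nodesE.
  (* Interpolation at [s] loses a factor [c], hence the factor [c.+1] in [big]. *)
  pose b := `|p.[k0%:R]| / c.+1%:R.
  have small k : ~~ big k -> c.+1%:R * `|p.[k%:R]| < `|p.[k0%:R]|.
    by rewrite /big real_leNgt ?negbK // ?realM ?normr_real ?realn.
  have s_b : {in s, forall k, `|p.[k%:R]| <= b}.
    move=> k /s_small/andP[/small/ltW lt_k _].
    by rewrite /b ler_pdivlMr ?ltr0n // mulrC.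
  have sz_s : size s = m.+1 by rewrite size_takel // size_filter.
  have := valP s p b sz_s; rewrite take_uniq ?filter_uniq ?iota_uniq //.
  have sN : all (fun i => i <= m + n)%N s.
    by apply/allP => k /s_small/andP[].
  move=> /(_ isT sN sz_p s_b k0 k0N).
  have : head 0%N s \in s by rewrite -nth0 mem_nth ?sz_s.
  move=> /s_small/andP[/small lt_k0 _].
  have p0 : 0 < `|p.[k0%:R]|.
    by apply: le_lt_trans lt_k0; rewrite mulr_ge0.
  rewrite /b mulrA ler_pdivlMr ?ltr0n // mulrC ler_pM2r //.
  by rewrite ler_nat ltnn.
exists (take n.+1 [seq k <- nodes | big k]); split.
- rewrite size_takel // size_filter; have := count_predC big nodes.
  rewrite size_iota => eqN; rewrite -(leq_add2r m) -/nodes.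
  by rewrite addSn [(n + m)%N]addnC -eqN leq_add2l.
- by rewrite take_uniq ?filter_uniq ?iota_uniq.
- by apply/allP => k /mem_take; rewrite mem_filter nodesE => /andP[].
- by move=> k /mem_take; rewrite mem_filter => /andP[].
Qed.

(** Newton's forward difference formula: the hypothesis says that the
    differences of [g] at 0 of orders [m + 1] to [N] vanish, so the Newton
    series of [g] has no term of degree above [m]. *)
Lemma newton_interpolation (F : numFieldType) (m N : nat) (g : nat -> F) :
    (m <= N)%N ->
    (forall d, (m < d <= N)%N ->
       \sum_(k < d.+1) (-1) ^+ k * 'C(d, k)%:R * g k = 0) ->
  exists2 p : {poly F}, (size p <= m.+1)%N &
    forall k, (k <= N)%N -> p.[k%:R] = g k.
Proof.
move=> mN vanish.
pose f d := \sum_(k < d.+1) (-1) ^+ k * 'C(d, k)%:R * g k.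
(* With the linear form [ev] that sends ['X^i] to [g i], the difference [f d]
   is the image of [(1 - 'X) ^+ d]; binomial inversion [gE] is then the expansion
   of ['X^k = (1 - (1 - 'X)) ^+ k]. *)
pose ev (p : {poly F}) := \sum_(i < N.+1) p`_i * g i.
have evD : {morph ev : p q / p + q >-> p + q}.
  by move=> p q; rewrite -big_split; apply: eq_bigr => i _; rewrite coefD mulrDl.
have evZ a p : ev (a *: p) = a * ev p.
  by rewrite mulr_sumr; apply: eq_bigr => i _; rewrite coefZ mulrA.
have ev0 : ev 0 = 0 by rewrite /ev big1 // => i _; rewrite coef0 mul0r.
have evX k : (k <= N)%N -> ev 'X^k = g k.
  move=> kN; rewrite /ev (bigD1 (Ordinal (kN : (k < N.+1)%N))) //= coefXn eqxx.
  rewrite mul1r big1 ?addr0 // => i ik; rewrite coefXn -val_eqE /= in ik *.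
  by rewrite (negPf ik) mul0r.
have evf d : (d <= N)%N -> ev ((1 - 'X) ^+ d) = f d.
  move=> dN; rewrite exprBn (big_morph ev evD ev0); apply: eq_bigr => i _.
  have iN : (i <= N)%N by rewrite (leq_trans _ dN) // -ltnS.
  rewrite expr1n mulr1 -mulr_natl mulrA -polyCN -polyC_exp -[_%:R]polyC_natr.
  by rewrite -polyCM mul_polyC evZ evX // [_%:R * _]mulrC.
have gE k : (k <= N)%N -> g k = \sum_(d < k.+1) (-1) ^+ d * 'C(k, d)%:R * f d.
  move=> kN; rewrite -evX // -[in LHS](subKr 1 'X) exprBn (big_morph ev evD ev0).
  apply: eq_bigr => d _.
  have dN : (d <= N)%N by rewrite (leq_trans _ kN) // -ltnS.
  rewrite expr1n mulr1 -mulr_natl mulrA -polyCN -polyC_exp -[_%:R]polyC_natr.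
  by rewrite -polyCM mul_polyC evZ evf // [_%:R * _]mulrC.
pose ff d : {poly F} := \prod_(i < d) ('X - i%:R%:P).
have ffE d k : (ff d).[k%:R] = (k ^_ d)%:R.
  rewrite /ff horner_prod; elim: d => [|d IH]; first by rewrite big_ord0 ffactn0.
  rewrite big_ord_recr /= IH ffactnSr natrM !hornerE.
  have [dk|kd] := leqP d k; first by rewrite natrB.
  by rewrite ffact_small // !mul0r.
pose a d : F := (-1) ^+ d * f d / d`!%:R.
exists (\sum_(d < m.+1) a d *: ff d) => [|k kN].
  rewrite (leq_trans (size_sum _ _ _)) //; apply/bigmax_leqP => d _.
  rewrite (leq_trans (size_scale_leq _ _)) //.
  by rewrite size_prod_XsubC -[index_enum _]enumT size_enum_ord.
rewrite horner_sum.
pose h d := (-1) ^+ d * 'C(k, d)%:R * f d.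
have hE d : (a d *: ff d).[k%:R] = h d.
  have d0 : d`!%:R != 0 :> F by rewrite pnatr_eq0 -lt0n fact_gt0.
  rewrite hornerZ ffE -bin_ffact natrM /a /h [_ * d`!%:R]mulrC.
  by rewrite mulrA divfK // mulrAC.
under eq_bigr do rewrite hE.
rewrite gE //.
(* The terms [h d] vanish for [m < d] because [f d] does, and for [k < d] because
   the binomial coefficient does. *)
have trunc M : (forall d, (M < d <= N)%N -> h d = 0) -> forall L, (L <= N)%N ->
    (M <= L)%N -> \sum_(d < M.+1) h d = \sum_(d < L.+1) h d.
  move=> h0 L LN ML; rewrite -!(big_mkord xpredT h).
  rewrite [RHS](big_cat_nat _ (n := M.+1)) //= [X in _ = _ + X]big_nat.
  rewrite [X in _ = _ + X]big1 ?addr0 // => d /andP[Md dL].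
  by rewrite h0 // Md (leq_trans _ LN).
have hm d : (m < d <= N)%N -> h d = 0.
  by move=> dN; rewrite /h /f vanish ?mulr0.
have hk d : (k < d <= N)%N -> h d = 0.
  by move=> /andP[kd _]; rewrite /h bin_small // mulr0 mul0r.
have [mk|km] := leqP m k; first exact: trunc.
by rewrite -(trunc k hk m) // ltnW.
Qed.

(** * Bounded definable sets over a closed field *)

(** The valuation that sends variable [j] to [t] and the other ones to 0. *)
Definition axis_point (F : fieldType) (j : nat) (t : F) : seq F :=
  set_nth 0 [::] j t.

Lemma rterm_axis_horner (F : fieldType) (j : nat) (u : GRing.term F) :
    GRing.rterm u ->
  exists p : {poly F}, forall t, GRing.eval (axis_point j t) u = p.[t].
Proof.
elim: u => //=.
- move=> i _; have [->|ij] := eqVneq i j.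
    by exists 'X => t; rewrite hornerX nth_set_nth /= eqxx.
  by exists 0 => t; rewrite horner0 nth_set_nth /= (negPf ij) nth_nil.
- by move=> c _; exists c%:P => t; rewrite hornerC.
- by move=> k _; exists k%:R%:P => t; rewrite hornerC.
- move=> u IHu v IHv /andP[/IHu[p pE] /IHv[q qE]].
  by exists (p + q) => t; rewrite hornerD pE qE.
- by move=> u IHu /IHu[p pE]; exists (- p) => t; rewrite hornerN pE.
- by move=> u IHu k /IHu[p pE]; exists (p *+ k) => t; rewrite hornerMn pE.
- move=> u IHu v IHv /andP[/IHu[p pE] /IHv[q qE]].
  by exists (p * q) => t; rewrite hornerM pE qE.
- by move=> u IHu k /IHu[p pE]; exists (p ^+ k) => t; rewrite horner_exp pE.
Qed.

Lemma finite_roots (F : fieldType) (p : {poly F}) :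
  p != 0 -> finite_set [set t | root p t].
Proof.
move=> p0; apply: contrapT => /infinite_set_fset -/(_ (size p))[rs rs_p].
rewrite leqNgt max_poly_roots ?finmap.fset_uniq //.
by apply/allP => t /rs_p.
Qed.

(** Equations in one variable define a finite set or the whole line, and the
    finite or cofinite sets form a Boolean algebra. *)
Lemma qf_axis_finite_or_cofinite (F : fieldType) (j : nat)
    (f : GRing.formula F) :
    GRing.qf_form f -> GRing.rformula f ->
  let A := [set t | GRing.qf_eval (axis_point j t) f] in
  finite_set A \/ cofinite_set A.
Proof.
pose tame (A : set F) := finite_set A \/ cofinite_set A.
have tameC A : tame A -> tame (~` A) by rewrite /tame setCK; tauto.
have tameI A B : tame A -> tame B -> tame (A `&` B).
  rewrite /tame setCI finite_setU => -[finA|finA].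
    by left; apply: finite_setIl.
  by case=> finB; [left; apply: finite_setIr | right].
rewrite -/(tame _) /=.
pose Z (f : GRing.formula F) :=
  [set t | GRing.qf_eval (axis_point j t) f].
elim: f => //=.
- case=> _ _; [right|left]; last by rewrite (_ : [set _ | _] = set0) // -subset0.
  by rewrite (_ : ~` _ = set0) // -subset0 => t [].
- move=> u v _ /andP[/(rterm_axis_horner j)[p pE] /(rterm_axis_horner j)[q qE]].
  have [eq_pq|pq] := eqVneq p q.
    right; rewrite (_ : ~` _ = set0) // -subset0 => t /=.
    by rewrite pE qE eq_pq eqxx.
  left; apply: (sub_finite_set _ (finite_roots (_ : p - q != 0))); last first.
    by rewrite subr_eq0.
  by move=> t /=; rewrite pE qE rootE !hornerE subr_eq0.
- move=> f IHf g IHg /andP[qf qg] /andP[rf rg].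
  have -> : [set t | GRing.qf_eval (axis_point j t) f &&
      GRing.qf_eval (axis_point j t) g] = Z f `&` Z g.
    by apply/seteqP; split=> t /= /andP.
  exact: tameI (IHf qf rf) (IHg qg rg).
- move=> f IHf g IHg /andP[qf qg] /andP[rf rg].
  have -> : [set t | GRing.qf_eval (axis_point j t) f ||
      GRing.qf_eval (axis_point j t) g] = ~` (~` Z f `&` ~` Z g).
    by rewrite setCI !setCK; apply/seteqP; split=> t /= /orP.
  by apply/tameC/tameI; apply: tameC; [apply: IHf | apply: IHg].
- move=> f IHf g IHg /andP[qf qg] /andP[rf rg].
  have -> : [set t | GRing.qf_eval (axis_point j t) f ==>
      GRing.qf_eval (axis_point j t) g] = ~` (Z f `&` ~` Z g).
    rewrite setCI setCK; apply/seteqP; split=> t /=; rewrite implybE.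
      by case/orP => [/negP|]; [left|right].
    by case=> [/negP ->|->] //; rewrite orbT.
  by apply/tameC/tameI; [apply: IHf | apply/tameC/IHg].
- move=> f IHf qf rf.
  have -> : [set t | ~~ GRing.qf_eval (axis_point j t) f] = ~` Z f.
    by apply/seteqP; split=> t /= /negP.
  exact/tameC/IHf.
Qed.

Lemma projection_finite_or_cofinite (F : closedFieldType) (I : seq nat)
    (j : nat) (f : GRing.formula F) :
  let A := [set t | GRing.holds (axis_point j t) (foldr GRing.Exists f I)] in
  finite_set A \/ cofinite_set A.
Proof.
set ex := foldr _ _ _.
pose qf := GRing.quantifier_elim (@ClosedFieldQE.ex_elim F) (GRing.to_rform ex).
have rf := GRing.to_rform_rformula ex.
have /andP[qf_qf rf_qf] :=
  GRing.quantifier_elim_wf (@ClosedFieldQE.wf_ex_elim F) rf.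
rewrite /= (_ : [set _ | _] = [set t | GRing.qf_eval (axis_point j t) qf]).
  exact: qf_axis_finite_or_cofinite.
have ok := ClosedFieldQE.holds_ex_elim (@GRing.solve_monicpoly F).
apply/seteqP; split=> t /=.
  move/GRing.to_rformP => ht.
  exact/(GRing.quantifier_elim_rformP (@ClosedFieldQE.wf_ex_elim F) ok _ rf).
move/(GRing.quantifier_elim_rformP (@ClosedFieldQE.wf_ex_elim F) ok _ rf).
by move/GRing.to_rformP.
Qed.

Lemma bounded_cofinite_false (F : numFieldType) (A : set F) (B : nat) :
  (forall t, A t -> `|t| <= B%:R) -> ~ cofinite_set A.
Proof.
move=> bA cofA; apply: infinite_nat.
rewrite -(setUv ((fun k : nat => k%:R : F) @^-1` A)) finite_setU; split.
  apply: (sub_finite_set _ (finite_II B.+1)) => k /bA /=.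
  by rewrite normr_nat ler_nat ltnS.
rewrite preimage_setC; apply: finite_preimage => //.
by move=> i k _ _ /eqP; rewrite eqr_nat => /eqP.
Qed.

(** Each coordinate takes finitely many values on [V]: the set of these values
    is defined by quantifying over the other coordinates, and it is bounded. *)
Lemma bounded_definable_finite (F : numClosedFieldType) (n B : nat)
    (f : GRing.formula F) (V : set 'rV[F]_n) :
    (forall x, V x <-> GRing.holds [seq x 0 j | j <- enum 'I_n] f) ->
    (forall x j, V x -> `|x 0 j| <= B%:R) ->
  finite_set V.
Proof.
move=> Vf VB.
have coordE x i (j : 'I_n) : i = j :> nat ->
    nth 0 [seq (x : 'rV[F]_n) 0 j | j <- enum 'I_n] i = x 0 j.
  by move=> ->; rewrite (nth_map j) ?size_enum_ord // nth_ord_enum.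
(* The quantified variables are the coordinates other than [j]; all variables from
   [n] on then keep the value 0 of [axis_point j t], which matches the default
   value 0 read beyond the end of the list of coordinates. *)
have finA (j : 'I_n) : finite_set [set x 0 j | x in V].
  pose I := [seq i <- iota 0 n | i != j :> nat].
  have I_E i : (i \in I) = (i != j :> nat) && (i < n)%N.
    by rewrite mem_filter mem_iota.
  have [|finC] := @projection_finite_or_cofinite F I j f.
    apply: sub_finite_set => t [x Vx <-] /=.
    apply/GRing.foldExistsP; exists [seq x 0 j | j <- enum 'I_n]; last exact/Vf.
    move=> i; rewrite !inE I_E negb_and negbK -leqNgt nth_set_nth /= nth_nil.
    have [->|ij] /= := eqVneq i (j : nat); first by rewrite (coordE x _ j).
    by move=> n_i; rewrite nth_default // size_map size_enum_ord.
  exfalso; apply: bounded_cofinite_false finC => // t /=.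
  move=> /GRing.foldExistsP[e same he].
  pose x := \row_(i < n) e`_i.
  have -> : t = x 0 j.
    have := same j; rewrite !inE I_E eqxx nth_set_nth /= eqxx => -> //.
    by rewrite mxE.
  apply: VB; apply/Vf; apply: GRing.eq_holds he => i.
  have [ni|i_n] := leqP n i; last by rewrite (coordE x _ (Ordinal i_n)) // mxE.
  rewrite [RHS]nth_default; last by rewrite size_map size_enum_ord.
  rewrite -same ?nth_set_nth /= ?nth_nil ?gtn_eqF ?(leq_trans _ ni) //.
  by rewrite !inE I_E negb_and -leqNgt ni orbT.
have /finite_seqP[s sE] :
    finite_set (\bigcup_(j in [set: 'I_n]) [set x 0 j | x in V]).
  by apply: bigcup_finite => [|j _]; [exact: finite_finset | exact: finA].
pose g (h : {ffun 'I_n -> seq_sub s}) : 'rV[F]_n := \row_j val (h j).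
apply: (sub_finite_set _ (finite_image g (@finite_finset _ setT))) => x Vx.
have xs j : x 0 j \in s.
  have : [set` s] (x 0 j) by rewrite -sE; exists j => //; exists x.
  by [].
exists [ffun j => SeqSub (xs j)] => //.
by apply/rowP => j; rewrite mxE ffunE.
Qed.

(** * The common roots in the torus are bounded *)

Lemma ln_prodX (R : realType) (n : nat) (r : 'I_n -> R) (e : 'I_n -> nat) :
  (forall j, 0 < r j) ->
  0 < \prod_j r j ^+ e j /\
  ln (\prod_j r j ^+ e j) = \sum_j (e j)%:R * ln (r j).
Proof.
move=> r_gt0; elim/big_ind2: _ => [|x a y b [x0 <-] [y0 <-]|j _].
- by rewrite ln1.
- by rewrite mulr_gt0 // lnM.
- by rewrite exprn_gt0 // lnXn // mulr_natl.
Qed.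

Lemma ln_normc_prodX (R : realType) (n : nat) (x : 'rV[R[i]]_n)
    (e : 'I_n -> nat) :
  torus R n x ->
  0 < normc (\prod_j x 0 j ^+ e j) /\
  ln (normc (\prod_j x 0 j ^+ e j)) = \sum_j (e j)%:R * ln (normc (x 0 j)).
Proof.
move=> xT.
have -> : normc (\prod_j x 0 j ^+ e j) = \prod_j normc (x 0 j) ^+ e j.
  rewrite (big_morph _ (@normcM R) (normc1 R)); apply: eq_bigr => j _.
  elim: (e j) => [|k IH]; first by rewrite normc1.
  by rewrite !exprS normcM IH.
apply: ln_prodX => j.
by have := xT j; rewrite -normr_gt0 (_ : `|_| = (normc (x 0 j))%:C%C) // ltcR.
Qed.

(** The core of the proof: on the integers up to [m + n], [g] agrees with a
    polynomial of degree at most [m], so [|g|] is within a constant factor of its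
    maximum at [n + 1] of them, while [ln |g|] is there a polynomial of degree at
    most [n] with coefficients [ln |x_j|]. *)
Lemma common_roots_torus_bounded (R : realType) (n m : nat) :
  exists B : nat, forall x, common_roots R m n x -> torus R n x ->
  forall j, `|x 0 j| <= B%:R.
Proof.
have [c largeP] := large_values R[i] n m.
have [K coefP] := coef_bound R (m + n) n.+1.
exists (Num.bound (expR (K%:R * ln c.+1%:R : R))) => x x_root xT j.
pose g k := \prod_(j < n) x 0 j ^+ (k ^ j.+1)%N.
have [|d /andP[md dN]|p sz_p pE] := @newton_interpolation R[i] m (m + n) g.
- exact: leq_addr.
- have := x_root (d - m)%N; rewrite subn_gt0 md leq_subLR dN subnKC ?(ltnW md) //.
  exact.
pose a k := normc (g k).
have normE (z : R[i]) : `|z| = (normc z)%:C%C by [].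
pose k0 := [arg max_(k > ord0 : 'I_(m + n).+1) a k]%O.
have k0_max k : (k <= m + n)%N -> a k <= a k0.
  rewrite -ltnS /k0 => kN; case: arg_maxP => // i _ /(_ (Ordinal kN)); exact.
have k0N : (k0 <= m + n)%N by rewrite -ltnS.
have [s [sz_s uniq_s sN s_large]] := largeP p k0 sz_p k0N.
have lnE k := ln_normc_prodX (fun j => k ^ j.+1)%N xT.
(* The logarithm of the maximum only enters the constant coefficient of [q], so
   a bound on the coefficients of [q] controls the [ln |x_j|] whatever the size of
   that maximum. *)
pose q : {poly R} :=
  \sum_(j < n) ln (normc (x 0 j)) *: 'X^(j.+1) - (ln (a k0))%:P.
have sz_q : (size q <= n.+1)%N.
  rewrite (leq_trans (size_polyD _ _)) // geq_max size_polyN.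
  rewrite (leq_trans (size_polyC_leq1 _)) // andbT.
  rewrite (leq_trans (size_sum _ _ _)) //; apply/bigmax_leqP => i _.
  by rewrite (leq_trans (size_scale_leq _ _)) // size_polyXn !ltnS.
have qE k : q.[k%:R] = ln (a k) - ln (a k0).
  rewrite /q hornerD hornerN hornerC horner_sum (lnE k).2; congr (_ - _).
  by apply: eq_bigr => i _; rewrite hornerZ hornerXn natrX mulrC.
have le_q : {in s, forall k, `|q.[k%:R]| <= ln c.+1%:R}.
  move=> k ks; have kN := allP sN k ks.
  rewrite qE distrC ger0_norm; last first.
    by rewrite subr_ge0 ler_ln ?posrE ?(lnE _).1 ?k0_max.
  rewrite lerBlDr -lnM ?posrE ?(lnE _).1 ?ltr0n //.
  rewrite ler_ln ?posrE ?mulr_gt0 ?(lnE _).1 ?ltr0n //.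
  have := s_large k ks; rewrite !pE // !normE -(rmorph_nat (real_complex R)).
  by rewrite -rmorphM lecR.
have := coefP s q _ sz_s uniq_s sN sz_q le_q j.+1.
rewrite /q coefB coefC subr0 coef_sum (bigD1 j) //= coefZ coefXn eqxx mulr1.
rewrite big1 ?addr0 => [ln_le|i ij]; last first.
  by rewrite coefZ coefXn eqSS eq_sym (inj_eq val_inj) (negPf ij) mulr0.
rewrite normE -(rmorph_nat (real_complex R)) lecR.
have x0 : 0 < normc (x 0 j) by have := xT j; rewrite -normr_gt0 normE ltcR.
rewrite -(lnK x0) (le_trans _ (ltW (archi_boundP (expR_ge0 _)))) // ler_expR.
exact: le_trans (ler_norm _) ln_le.
Qed.

(** * The common roots in the torus form a definable set *)

Definition fpoly_term (F : fieldType) (d n : nat) : GRing.term F :=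
  \big[GRing.Add/GRing.NatConst F 0]_(k < d.+1)
    GRing.Mul (GRing.Const ((-1) ^+ k * 'C(d, k)%:R))
      (\big[GRing.Mul/GRing.NatConst F 1]_(j < n)
          GRing.Exp (GRing.Var F j) (k ^ j.+1)%N).

Lemma eval_fpoly_term (F : fieldType) (d n : nat) (x : 'rV[F]_n) :
  GRing.eval [seq x 0 j | j <- enum 'I_n] (fpoly_term F d n) = fpoly d x.
Proof.
rewrite (big_morph (GRing.eval _) (fun _ _ => erefl) (erefl _)).
apply: eq_bigr => k _ /=; congr (_ * _).
rewrite (big_morph (GRing.eval _) (fun _ _ => erefl) (erefl _)).
by apply: eq_bigr => j _ /=; rewrite (nth_map j) ?size_enum_ord // nth_ord_enum.
Qed.

Lemma holds_big_and (F : fieldType) (e : seq F) (I : eqType) (s : seq I)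
    (f : I -> GRing.formula F) :
  GRing.holds e (\big[GRing.And/GRing.True]_(i <- s) f i) <->
  forall i, i \in s -> GRing.holds e (f i).
Proof.
elim: s => [|i s IH]; first by rewrite big_nil.
rewrite big_cons /= IH; split=> [[fi fs] k|fs].
  by rewrite inE => /orP[/eqP->|/fs].
by split=> [|k ks]; apply: fs; rewrite ?mem_head // inE ks orbT.
Qed.

Definition torus_root_formula (F : fieldType) (m n : nat) : GRing.formula F :=
  GRing.And
    (\big[GRing.And/GRing.True]_(i <- iota 1 n)
       GRing.Equal (fpoly_term F (m + i) n) (GRing.NatConst F 0))
    (\big[GRing.And/GRing.True]_(j <- enum 'I_n)
       GRing.Not (GRing.Equal (GRing.Var F j) (GRing.NatConst F 0))).

Lemma torus_root_formulaP (R : realType) (m n : nat) (x : 'rV[R[i]]_n) :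
  (common_roots R m n `&` torus R n) x <->
  GRing.holds [seq x 0 j | j <- enum 'I_n] (torus_root_formula R[i] m n).
Proof.
rewrite /= !holds_big_and; split=> -[roots xT]; split.
- move=> i; rewrite mem_iota add1n ltnS => iN.
  by rewrite /= eval_fpoly_term roots.
- move=> j _ /=; rewrite (nth_map j) ?size_enum_ord // nth_ord_enum.
  exact/eqP/xT.
- move=> i iN; rewrite -eval_fpoly_term.
  by apply: (roots i); rewrite mem_iota add1n ltnS.
- move=> j; have := xT j; rewrite mem_enum => /(_ isT) /=.
  by rewrite (nth_map j) ?size_enum_ord // nth_ord_enum => /eqP.
Qed.

(** * Finiteness and isolation *)

Lemma common_roots1 (R : realType) (m n : nat) :
  common_roots R m n (const_mx 1).
Proof.
move=> i /andP[i_gt0 _].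
have : (1 - 1 : R[i]) ^+ (m + i) = 0.
  by rewrite subrr expr0n addn_eq0 (gtn_eqF i_gt0) andbF.
rewrite exprBn => <-; apply: eq_bigr => k _.
rewrite big1 ?mulr1 => [|j _]; last by rewrite mxE expr1n.
by rewrite !expr1n !mulr1 mulr_natr.
Qed.

Lemma nbhs_torus1 (R : realType) (n : nat) :
  nbhs (const_mx 1 : 'rV[R[i]]_n) (torus R n).
Proof.
have coord_neq0 (j : 'I_n) :
    nbhs (const_mx 1 : 'rV[R[i]]_n) [set x | x 0 j != 0].
  have coordj := @coord_continuous R[i] 1 n 0 j (const_mx 1).
  by apply: (@cvgr_neq0 R[i] R[i] _ _ _ _ _ coordj); rewrite mxE oner_neq0.
exact: filter_forall coord_neq0.
Qed.

(** Removing from [U] the finitely many other points of [A] leaves a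
    neighborhood of [x], because finite sets are closed. *)
Lemma isolated_finite_open (T : topologicalType) (A U : set T) (x : T) :
    accessible_space T ->
    A x -> nbhs x U -> finite_set (A `&` U) -> isolated A x.
Proof.
move=> T1 Ax xU finAU; split; first exact/mem_set.
exists (U `&` ~` ((A `&` U) `\ x)).
  apply: filterI => //; apply: open_nbhs_nbhs; split; last by case=> _ /(_ erefl).
  apply: closed_openC.
  exact: (iffLR accessible_finite_set_closed T1 _ (finite_setD _ finAU)).
apply/seteqP; split=> y /= => [[[Uy nA] Ay]|->].
  by apply: contrapT => yx; apply: nA.
by split=> //; split; [exact: nbhs_singleton | case=> _ /(_ erefl)].
Qed.

Theorem proposition7p3 (R : realType) (n m : nat)
    (hn : (1 <= n)%N) (hm : (1 <= m)%N) :
  finite_set (common_roots R m n `&` torus R n) /\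
  isolated (common_roots R m n) (const_mx 1).
Proof.
have [B bnd] := common_roots_torus_bounded R n m.
have fin : finite_set (common_roots R m n `&` torus R n).
  apply: bounded_definable_finite (@torus_root_formulaP R m n) _ => x j [].
  move=> xr xT; exact: bnd.
split=> //.
apply: isolated_finite_open (@common_roots1 R m n) (nbhs_torus1 R n) fin.
exact/hausdorff_accessible/norm_hausdorff.
Qed.
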